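(* Let $T$ be a tree and let $f:T\to T$ be a continuous map. Then each $A\in\mathrm{Con}(T)$ is either asymptotically periodic under $f$ or asymptotically degenerate under $f$ (or both). That is, for each $A\in\mathrm{Con}(T)$, at least one of the following holds: there is an integer $p\ge1$ such that the sequence $\{f^{pn}(A)\}_{n\ge0}$ converges in $\mathrm{Con}(T)$; or $\operatorname{diam} f^n(A)\to0$ as $n\to\infty$.
   Context: An interval is any space homeomorphic to $[0,1]\subset\mathbb{R}$. A tree is a uniquely arcwise connected space that is either a single point or a union of finitely many intervals; here it is regarded as a metric space with some fixed compatible metric, and $\operatorname{diam}$ denotes the diameter of a set in this metric. A continuum is a nonempty compact connected metric space. $\mathrm{Con}(T)$ denotes the set of all subcontinua of $T$ (including singletons), endowed with the topology induced by the Hausdorff metric. *)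

(* Defs.v *)
From mathcomp Require Import all_boot all_order all_algebra.
From mathcomp Require Import all_classical all_reals all_analysis.

Set Implicit Arguments.
Unset Strict Implicit.
Unset Printing Implicit Defensive.

Import Order.TTheory GRing.Theory Num.Theory.
Import numFieldNormedType.Exports.

Local Open Scope classical_set_scope.
Local Open Scope ring_scope.

(* [h] and [g] restrict to mutually inverse homeomorphisms between the subspaces
   [A] and [B]; their values outside [A] and [B] are irrelevant. *)
Definition homeomorphism_on (X Y : topologicalType) (A : set X) (B : set Y)
    (h : X -> Y) (g : Y -> X) : Prop :=
  [/\ set_fun A B h, set_fun B A g, {in A, cancel h g} & {in B, cancel g h}] /\
  {within A, continuous h} /\ {within B, continuous g}.

(* The intervals lying in [T], i.e. its subspaces homeomorphic to [0, 1]. *)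
Definition interval_in (R : realType) (T : metricType R) (J : set T) : Prop :=
  exists (h : R -> T) (g : T -> R), homeomorphism_on (`[0, 1] : set R) J h g.

Definition arc_between (R : realType) (T : metricType R) (x y : T)
    (J : set T) : Prop :=
  exists (h : R -> T) (g : T -> R),
    [/\ homeomorphism_on (`[0, 1] : set R) J h g, h 0 = x & h 1 = y].

Definition uniquely_arcwise_connected (R : realType) (T : metricType R) : Prop :=
  forall x y : T, x <> y -> exists! J : set T, arc_between x y J.

Definition is_tree (R : realType) (T : metricType R) : Prop :=
  uniquely_arcwise_connected T /\
  ((exists x : T, [set: T] = [set x]) \/
   (exists (n : nat) (J : 'I_n.+1 -> set T),
      (forall i, interval_in (J i)) /\ \bigcup_i J i = [set: T])).

Definition Con (R : realType) (T : metricType R) : set (set T) :=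
  [set A | [/\ A !=set0, compact A & connected A]].

(* Suprema and infima are taken in the extended reals, so that no convention for
   unbounded sets is involved. *)
Definition diam (R : realType) (T : metricType R) (A : set T) : \bar R :=
  ereal_sup [set (mdist z.1 z.2)%:E | z in A `*` A].

Definition dist_to (R : realType) (T : metricType R) (x : T) (A : set T) :
    \bar R :=
  ereal_inf [set (mdist x a)%:E | a in A].

Definition hausdorff_dist (R : realType) (T : metricType R) (A B : set T) :
    \bar R :=
  maxe (ereal_sup [set dist_to a B | a in A])
       (ereal_sup [set dist_to b A | b in B]).

Definition Con_converges (R : realType) (T : metricType R) (u : nat -> set T) :
    Prop :=
  exists2 B : set T, Con B & hausdorff_dist (u n) B @[n --> \oo] --> 0%E.

Definition asymptotically_periodic (R : realType) (T : metricType R)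
    (f : T -> T) (A : set T) : Prop :=
  exists2 p : nat, (1 <= p)%N & Con_converges (fun n => iter (p * n) f @` A).

Definition asymptotically_degenerate (R : realType) (T : metricType R)
    (f : T -> T) (A : set T) : Prop :=
  diam (iter n f @` A) @[n --> \oo] --> 0%E.

(* Main.v *)
Require Import Defs.
From mathcomp Require Import all_boot all_order all_algebra.
From mathcomp Require Import all_classical all_reals all_analysis.
From mathcomp Require Import lra zify.
Import numFieldNormedType.Exports.

(** Fix a root c in the tree and say that x is below y when x lies on the
    segment from c to y. Whatever the root, the segments from c to the endpoints
    of the finitely many intervals that make up the tree are chains covering it
    ([tree_cover]), and a connected set containing c is closed downwards
    ([connected_seg]). Two cases are treated, each with a root of its own.

    Suppose first that some image of A contains a periodic point c, say f^p(c) = c;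
    replace A by that image. Put g = f^p and take c as root; write K for the number
    of chains. Among K + 1 consecutive points of a g-orbit two lie on the same
    chain, q <= K steps apart. If the later one is above the earlier one y, then
    g^q stretches the segment from c to y over itself, so that whatever is reached
    from y is reached again q, 2q, 3q steps later. If it is below, the q steps can
    be skipped, because the sets involved are closed downwards. Let N be a common
    multiple of 1, 2, up to K. A long orbit with no stretching offers N / q skips of
    one and the same length q, that is, a shortening by exactly N. Hence, for n large, a point of g^n(A) belongs either
    to g^(n-N)(A) or to all the sets g^(n+aN)(A) ([skip_or_stay]). Along a residue
    class modulo N each point is then eventually in or eventually out, and since
    the sets are closed downwards this forces Hausdorff convergence
    ([star_converges]).

    Suppose now that no f^n(A) contains a periodic point. If the diameters did not
    tend to 0, some point would lie in infinitely many of the f^n(A) ([recurrent_point]), so f^r(A)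
    would meet f^(r+p)(A) for some r and p >= 1. With g = f^p the union U of the
    g^n(f^r(A)) is connected, mapped into itself and free of periodic points.
    Following from a root c of U the points that g moves away from c, one leaves U
    at a point z of its closure ([drift_end]), and U is attracted to z near z.
    Seen from z, an orbit in U never comes back on the far side of one of its own
    points, since an iterate of g would have a fixed point in between
    ([never_behind]); so on each of the finitely many chains rooted at z it
    descends, and its limit points are periodic points of the closure of U which
    can only be z ([orbit_trapped]). By compactness g^n(f^r(A)) shrinks to z,
    whence the diameters of all f^n(A) tend to 0 after all. *)

Set Implicit Arguments.
Unset Strict Implicit.
Unset Printing Implicit Defensive.

Import Order.TTheory GRing.Theory Num.Theory.

Local Open Scope classical_set_scope.
Local Open Scope ring_scope.

(** * Injective paths in a metric space *)

Lemma within_comp (X Y Z : topologicalType) (A : set X) (B : set Y)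
    (f : Y -> Z) (phi : X -> Y) :
  {within B, continuous f} -> continuous phi -> set_fun A B phi ->
  {within A, continuous (f \o phi)}.
Proof.
move=> /subspace_continuousP cf cphi AB; apply/subspace_continuousP => x Ax.
move=> W /(cf _ (AB _ Ax)) /= /cphi; rewrite /within /= /nbhs /=.
by apply: filterS => z /= + Az; apply; exact: AB.
Qed.

Section paths.
Context {R : realType} {T : metricType R}.
Implicit Types (h : R -> T) (J : set T).

Definition inj_path (a b : R) h :=
  {within `[a, b], continuous h} /\ {in `[a, b] &, injective h}.

Lemma arc_between_path x y J : arc_between x y J ->
  exists h, [/\ inj_path 0 1 h, h 0 = x, h 1 = y & J = h @` `[0, 1]].
Proof.
move=> [h [g [[[hJ gI hK gK] [ch cg]] h0 h1]]]; exists h; split => //.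
  split=> // s t s01 t01 hst.
  by rewrite -(hK s) ?mem_setE// -(hK t) ?mem_setE// hst.
rewrite eqEsubset; split=> [u Ju|_ [t t01 <-]]; last exact: hJ.
by exists (g u); [exact: gI|rewrite gK// inE].
Qed.

(** A continuous injection of a compact interval is a homeomorphism onto its
    image, because it maps closed sets to compact sets. *)
Lemma path_inverse_continuous h (g : T -> R) (a b : R) : inj_path a b h ->
  {in `[a, b], cancel h g} -> {within h @` `[a, b], continuous g}.
Proof.
move=> [ch ih] hK; apply/continuous_closedP => D cD; apply/closed_subspaceP.
exists (h @` (`[a, b] `&` D)).
  apply: compact_closed; first exact: metric_hausdorff.
  apply: continuous_compact.
    by apply: continuous_subspaceW ch; exact: subIsetl.
  apply: (@subclosed_compact _ _ `[a, b]); last exact: subIsetl.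
    by apply: closedI => //; exact: interval_closed.
  exact: segment_compact.
rewrite eqEsubset; split=> u [].
  by move=> [t [tab Dt] <-] _; split; [change (D (g (h t))); rewrite hK|exists t].
move=> Dg [t tab ht]; split; last by exists t.
by exists t => //; split=> //; move: Dg; rewrite -ht => Dg; rewrite -(hK t tab).
Qed.

Lemma path_arc h (a b : R) : a < b -> inj_path a b h ->
  arc_between (h a) (h b) (h @` `[a, b]).
Proof.
move=> ab [ch ih].
pose phi (t : R) : R := a + t * (b - a).
have ba : 0 < b - a by rewrite subr_gt0.
have phi_in t : t \in `[0, 1] -> phi t \in `[a, b].
  by rewrite !in_itv/= /phi => /andP[t0 t1]; nra.
have cphi : continuous phi.
  by move=> t; apply: cvgD; [exact: cvg_cst|apply: cvgM];
    [exact: cvg_id|exact: cvg_cst].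
have ip : inj_path 0 1 (h \o phi).
  split; first by apply: within_comp ch cphi _ => t /= /phi_in.
  move=> s t /phi_in s01 /phi_in t01 /= /(ih _ _ s01 t01)/addrI/mulIf; apply.
  by rewrite gt_eqF.
have -> : h @` `[a, b] = (h \o phi) @` `[0, 1].
  rewrite eqEsubset; split=> _ [t /= t01 <-]; last first.
    by exists (phi t) => //; exact: phi_in.
  have tE : phi ((t - a) / (b - a)) = t by rewrite /phi divfK ?gt_eqF// addrC subrK.
  exists ((t - a) / (b - a)); last by rewrite /= tE.
  move: t01; rewrite /= !in_itv/= => /andP[ta tb].
  apply/andP; split; first by rewrite divr_ge0 ?subr_ge0// ltW.
  by rewrite ler_pdivrMr// mul1r lerB.
pose g u := xget 0 [set t | t \in `[0, 1]%R /\ h (phi t) = u].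
have hK : {in `[0, 1], cancel (h \o phi) g}.
  move=> t t01; rewrite /g; case: xgetP => [s _ [s01 /(ip.2 _ _ s01 t01)//]|].
  by move=> /(_ t)[].
exists (h \o phi), g; split.
- split; last by split; [exact: ip.1|exact: path_inverse_continuous].
  split.
  + by move=> t t01; exists t.
  + by move=> _ [t t01 <-]; rewrite -[X in g X]/((h \o phi) t) hK.
  + by move=> t; rewrite inE => /hK.
  + by move=> u; rewrite inE => -[t t01 <-]; rewrite [in LHS]hK.
- by rewrite /= /phi mul0r addr0.
- by rewrite /= /phi mul1r addrC subrK.
Qed.

Lemma sub_path (a b c d : R) h : inj_path a b h -> a <= c -> d <= b ->
  inj_path c d h.
Proof.
move=> [ch ih] ac db; have sub t : t \in `[c, d] -> t \in `[a, b].
  by rewrite !in_itv/= => /andP[ct td]; rewrite (le_trans ac)// (le_trans td).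
split; last by move=> s t /sub + /sub; exact: ih.
by apply: continuous_subspaceW ch => t /= /sub.
Qed.

Lemma rev_path (b : R) h : inj_path 0 b h -> inj_path 0 b (fun t => h (b - t)).
Proof.
move=> [ch ih]; have sub t : t \in `[0, b] -> b - t \in `[0, b].
  by rewrite !in_itv/=; lra.
split.
  apply: (within_comp ch (phi := fun t => b - t)) => [t|t /= /sub//].
  by apply: cvgB; [exact: cvg_cst|exact: cvg_id].
by move=> s t sI tI /(ih _ _ (sub _ sI) (sub _ tI))/subrI.
Qed.

(** Two arcs issued from the same point are glued into one arc between their far
    ends: run back along h from h 1 to the last point h t0 = k s0 that h shares
    with the range of k, then follow k. The parameter 0 is the bend. *)
Lemma bent_path h k (t0 s0 : R) : inj_path 0 1 h -> inj_path 0 1 k ->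
  t0 \in `[0, 1] -> s0 \in `[0, 1] -> h t0 = k s0 ->
  (forall t s, t \in `[t0, 1] -> s \in `[s0, 1] -> h t = k s -> t = t0) ->
  inj_path (t0 - 1) (1 - s0) (fun t => if t <= 0 then h (t0 - t) else k (s0 + t)).
Proof.
set m := fun t => _; rewrite !in_itv/= => hp kp t0I s0I hk disj.
have sub1 t : t \in `[t0 - 1, 0] -> t0 - t \in `[0, 1].
  by rewrite !in_itv/=; lra.
have sub2 t : t \in `[0, 1 - s0] -> s0 + t \in `[0, 1].
  by rewrite !in_itv/=; lra.
split.
  have -> : [set` `[t0 - 1, 1 - s0]] = [set` `[t0 - 1, 0]] `|` [set` `[0, 1 - s0]].
    rewrite eqEsubset; split=> t /=; rewrite !in_itv/=; last by case; lra.
    by case: (leP t 0); [left|right]; lra.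
  apply: withinU_continuous; [exact: interval_closed|exact: interval_closed| |].
  - apply: (@subspace_eq_continuous _ _ _ (h \o (fun t => t0 - t))).
      by move=> t; rewrite inE/= in_itv/= => /andP[_ t0']; rewrite /m/= /from_subspace t0'.
    apply: (within_comp hp.1) => [t|t /= /sub1//].
    by apply: cvgB; [exact: cvg_cst|exact: cvg_id].
  - apply: (@subspace_eq_continuous _ _ _ (k \o (fun t => s0 + t))).
      move=> t; rewrite inE/= in_itv/= => /andP[t0' _]; rewrite /m/= /from_subspace.
      case: ifPn => // t0''; have -> : t = 0 by lra.
      by rewrite addr0 subr0.
    apply: (within_comp kp.1) => [t|t /= /sub2//].
    by apply: cvgD; [exact: cvg_cst|exact: cvg_id].
have mixed s t : s \in `[t0 - 1, 0] -> 0 < t -> t <= 1 - s0 ->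
    h (t0 - s) = k (s0 + t) -> False.
  rewrite in_itv/= => sI t_gt t_le hkE.
  have sE : t0 - s = t0 by apply: (disj _ (s0 + t)) => //; rewrite in_itv/=; lra.
  have : s0 = s0 + t.
    by apply: kp.2; rewrite ?in_itv/=; [lra|lra|rewrite -hkE sE].
  by lra.
move=> s t; rewrite !in_itv/= /m => sI tI.
case: ifPn => s0'; case: ifPn => t0'.
- move/hp.2 => /=; rewrite !in_itv/= => H; suff : t0 - s = t0 - t by lra.
  by apply: H; lra.
- move=> hkE; exfalso; apply: (mixed s t) => //; rewrite ?in_itv/=; lra.
- move=> /esym hkE; exfalso; apply: (mixed t s) => //; rewrite ?in_itv/=; lra.
- move/kp.2 => /=; rewrite !in_itv/= => H; suff : s0 + s = s0 + t by lra.
  by apply: H; lra.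
Qed.

End paths.

(** * Sequences of points and of sets *)

(** The count is a sum of booleans so that it can be updated one term at a time. *)
Lemma pigeonhole_count (K N : nat) (q : nat -> nat) : (0 < N)%N ->
  (forall t, (q t <= K)%N) ->
  exists r : nat, (N <= \sum_(s < K.+1 * N) (q s == r))%N.
Proof.
move=> N0 qK; apply: contrapT => nex.
have le_cnt (r : nat) : (\sum_(s < K.+1 * N) (q s == r) <= N.-1)%N.
  rewrite -ltnS prednK// ltnNge; apply/negP => H; apply: nex; by exists r.
have : (\sum_(r < K.+1) \sum_(s < K.+1 * N) (q s == r) <= \sum_(r < K.+1) N.-1)%N.
  by apply: leq_sum => r _; exact: le_cnt.
rewrite exchange_big/= sum_nat_const card_ord.
under eq_bigr => s _.
  have qs : (q s < K.+1)%N by rewrite ltnS.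
  rewrite (bigD1 (Ordinal qs))//= eqxx big1 ?addn0; last first.
    move=> r /eqP rq; apply/eqP; rewrite eqb0; apply/eqP => qr.
    by apply: rq; exact: val_inj.
  over.
by rewrite sum_nat_const card_ord muln1 leq_pmul2l// -ltnS prednK// ltnn.
Qed.

Lemma pigeonhole_frequently (F : finType) (P : F -> nat -> Prop) :
  (forall n, exists2 m, (n <= m)%N & exists f, P f m) ->
  exists f, forall n, exists2 m, (n <= m)%N & P f m.
Proof.
move=> often; apply: contrapT => nex.
have /choice[b bP] f : exists n, forall m, (n <= m)%N -> ~ P f m.
  apply: contrapT => H; apply: nex; exists f => n; apply: contrapT => H'.
  by apply: H; exists n => m nm Pm; apply: H'; exists m.
have [m bm [f Pf]] := often (\max_f b f)%N.
by apply: bP Pf; apply: leq_trans bm; exact: leq_bigmax.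
Qed.

Lemma frequently (P : nat -> Prop) : ~ (\forall n \near \oo, P n) ->
  forall n, exists2 m, (n <= m)%N & ~ P m.
Proof.
move=> nP n; apply: contrapT => H; apply: nP; exists n => // m /= nm.
by apply: contrapT => nPm; apply: H; exists m.
Qed.

(** Cluster points of a subsequence, the set M of its indices being given as a
    predicate so that no extraction has to be carried out. *)
Lemma compact_cluster_seq (X : topologicalType) (C : set X) (u : nat -> X)
    (M : nat -> Prop) : compact C ->
  (forall n, exists2 m, (n <= m)%N & M m) -> (forall m, M m -> C (u m)) ->
  exists2 y, C y & forall O, nbhs y O -> forall n,
    exists m, [/\ (n <= m)%N, M m & O (u m)].
Proof.
move=> cC infM CM.
pose D (n : nat) := u @` [set m | (n <= m)%N /\ M m].
have FF : ProperFilter (filter_from [set: nat] D).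
  apply: filter_from_proper; last first.
    by move=> n _; have [m nm Mm] := infM n; exists (u m), m.
  apply: filter_from_filter; first by exists 0%N.
  move=> i j _ _; exists (maxn i j) => // _ [m [+ Mm] <-].
  by rewrite geq_max => /andP[im jm]; split; exists m.
have FC : filter_from [set: nat] D C.
  by exists 0%N => // _ [m [_ Mm] <-]; exact: CM.
have [y [Cy cy]] := cC _ FF FC; exists y => // O Oy n.
have [_ [[m [nm Mm] <-] Om]] := cy (D n) O (ex_intro2 _ _ n I (fun _ => id)) Oy.
by exists m.
Qed.

Lemma cvge0 (R : realType) (x : nat -> \bar R) : (forall n, 0 <= x n)%E ->
  (forall e : R, 0 < e -> \forall n \near \oo, (x n <= e%:E)%E) ->
  x n @[n --> \oo] --> 0%E.
Proof.
move=> x0 xe P P0.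
have /nbhs_ballP[e /= e0 eP] : nbhs (0 : R) (P \o EFin) := P0.
have := xe _ (divr_gt0 e0 (ltr0n _ 2)); apply: filterS => n /=.
have := x0 n; case: (x n) => [r| |]//=; rewrite !lee_fin => r0 re.
apply: eP; rewrite /ball/= sub0r normrN ger0_norm//.
by rewrite (le_lt_trans re)// ltr_pdivrMr// mulr_natr mulr2n ltrDl.
Qed.

Lemma iter_continuous (X : topologicalType) (h : X -> X) (n : nat) :
  continuous h -> continuous (iter n h).
Proof.
move=> ch; elim: n => [|n IH] x; first exact: cvg_id.
by move=> W /(@ch (iter n h x)) /(IH x).
Qed.

Section metric.
Context {R : realType} {T : metricType R}.
Implicit Types (x y : T).

Lemma closed_set1 x : closed [set x].
Proof. by apply: compact_closed; [exact: metric_hausdorff|exact: compact_set1]. Qed.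

Lemma near_neq x y : x <> y -> \forall y' \near y, x <> y'.
Proof.
move=> xy; have := @open_nbhs_nbhs _ y (~` [set x]).
have oC : open (~` [set x]).
  by apply: closed_openC; exact: closed_set1.
move=> /(_ (conj oC (fun yx => xy (esym yx)))).
by apply: filterS => z zx xz; exact: zx.
Qed.

Lemma mdist_nbhs (x : T) (r : R) : 0 < r -> nbhs x [set y | mdist x y < r].
Proof. by move=> r0; have := nbhsx_ballx x _ r0; rewrite ballEmdist. Qed.

Lemma hausdorff_cvg0 (u : nat -> set T) (L : set T) :
  (forall n, u n !=set0) -> L !=set0 ->
  (forall e : R, 0 < e -> \forall n \near \oo,
    (forall a, u n a -> exists2 b, L b & mdist a b < e) /\
    (forall b, L b -> exists2 a, u n a & mdist b a < e)) ->
  hausdorff_dist (u n) L @[n --> \oo] --> 0%E.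
Proof.
move=> u0 L0 uL.
have sup_ge0 (C D : set T) : C !=set0 -> (0 <= ereal_sup [set dist_to a D | a in C])%E.
  move=> [a Ca]; apply: (@le_trans _ _ (dist_to a D)).
    by apply: le_ereal_inf_tmp => _ [b _ <-]; rewrite lee_fin mdist_ge0.
  by apply: ereal_sup_ubound; exists a.
have sup_le (C D : set T) (e : R) : (forall a, C a -> exists2 b, D b & mdist a b < e) ->
    (ereal_sup [set dist_to a D | a in C] <= e%:E)%E.
  move=> CD; apply: ge_ereal_sup => _ [a /CD[b Db abe] <-].
  apply: (@le_trans _ _ (mdist a b)%:E); last by rewrite lee_fin ltW.
  by apply: ereal_inf_lbound; exists b.
apply: cvge0 => [n|e e0]; first by rewrite le_max sup_ge0.
have := uL e e0; apply: filterS => n [uLn Lun].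
by rewrite ge_max; apply/andP; split; exact: sup_le.
Qed.

Lemma diam_cvg0 (u : nat -> set T) : (forall n, u n !=set0) ->
  (forall e : R, 0 < e -> \forall n \near \oo,
     forall x y, u n x -> u n y -> mdist x y < e) ->
  diam (u n) @[n --> \oo] --> 0%E.
Proof.
move=> u0 small; apply: cvge0 => [n|e e0].
  have [x ux] := u0 n; apply: ereal_sup_ubound.
  by exists (x, x) => //=; rewrite mdistxx.
have := small e e0; apply: filterS => n un.
apply: ge_ereal_sup => _ [[x y] /= [ux uy] <-].
by rewrite lee_fin ltW// un.
Qed.

Lemma Con_converges_shift (k : nat) (u : nat -> set T) :
  Con_converges (fun n => u (n + k)%N) -> Con_converges u.
Proof.
move=> [B CB uB]; exists B => //; rewrite -(cvg_shiftn k).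
exact: uB.
Qed.

Lemma iter_image (f : T -> T) (m n : nat) (A : set T) :
  iter m f @` (iter n f @` A) = iter (m + n) f @` A.
Proof.
rewrite image_comp; apply: eq_imagel => x _; by rewrite /= iterD.
Qed.

Lemma chain_connected (B : nat -> set T) : (forall n, connected (B n)) ->
  (forall n, B n `&` B n.+1 !=set0) -> connected (\bigcup_n B n).
Proof.
move=> cB BB; pose C n := \bigcup_(k in [set k | (k <= n)%N]) B k.
have -> : \bigcup_n B n = \bigcup_n C n.
  rewrite eqEsubset; split=> x [n _].
    by move=> Bx; exists n => //; exists n => /=.
  by move=> [k _ Bx]; exists k.
apply: bigcup_connected.
  have [x [B0x _]] := BB 0%N.
  by exists x => n _; exists 0%N => /=.
move=> n _; elim: n => [|n IH].
  rewrite /C (_ : [set k | (k <= 0)%N] = [set 0%N]) ?bigcup_set1//.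
  by rewrite eqEsubset; split=> k /=; rewrite leqn0 => /eqP.
have -> : C n.+1 = C n `|` B n.+1.
  rewrite eqEsubset; split=> [x [k /= kn Bx]|x [[k /= kn Bx]|Bx]].
  - move: kn; rewrite leq_eqVlt => /predU1P[<-|kn]; [by right|left].
    by exists k.
  - by exists k => //=; exact: leqW.
  - by exists n.+1 => /=.
apply: connectedU => //.
by have [x [Bx Bx']] := BB n; exists x; split=> //; exists n => /=.
Qed.

End metric.

(** * Segments of a tree *)

Section tree.
Context {R : realType} {T : metricType R}.
Context (hT : is_tree T).
Let uac : uniquely_arcwise_connected T := hT.1.
Implicit Types (h : R -> T) (x y c w : T).

(** For x <> y at most one J occurs and seg x y is the arc from x to y; the first
    disjunct makes seg x x a point. *)
Definition seg x y : set T :=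
  [set w | w = x \/ exists2 J, arc_between x y J & J w].

Lemma arc_neq x y (J : set T) : arc_between x y J -> x <> y.
Proof.
move=> /arc_between_path[h [[_ ih] <- <- _]] /ih.
by rewrite !in_itv/= !lexx !ler01 => /(_ isT isT)/eqP; rewrite eq_sym oner_eq0.
Qed.

Lemma segxx x : seg x x = [set x].
Proof.
by rewrite eqEsubset; split=> w => [[//|[J /arc_neq]]|->]; [|left].
Qed.

Lemma seg_arc x y (J : set T) : arc_between x y J -> seg x y = J.
Proof.
move=> xyJ; have [h [_ h0 _ JE]] := arc_between_path xyJ.
rewrite eqEsubset; split=> w; last by right; exists J.
case=> [->|[J' xyJ']].
  by rewrite JE -h0; exists 0 => //=; rewrite in_itv/= lexx ler01.
have [J0 [_ J0U]] := uac (arc_neq xyJ).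
by rewrite -(J0U _ xyJ) -(J0U _ xyJ').
Qed.

Lemma seg_param x y : x <> y -> exists h,
  [/\ inj_path 0 1 h, h 0 = x, h 1 = y & seg x y = h @` `[0, 1]].
Proof.
move=> xy; have [J [xyJ _]] := uac xy.
by have [h [ih h0 h1 JE]] := arc_between_path xyJ; exists h; rewrite (seg_arc xyJ).
Qed.

Lemma seg_path h a b : inj_path a b h -> a <= b ->
  seg (h a) (h b) = h @` `[a, b].
Proof.
rewrite le_eqVlt => hp /predU1P[->|ab]; last exact/seg_arc/path_arc.
rewrite segxx eqEsubset; split=> [_ ->|_ [t /= + <-]].
  by exists b => //=; rewrite in_itv/= lexx.
by rewrite in_itv/= -eq_le => /eqP ->.
Qed.

Lemma seg_sub_path h a b s t : inj_path a b h -> a <= s -> s <= t -> t <= b ->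
  seg (h s) (h t) = h @` `[s, t].
Proof. by move=> hp as_ st tb; apply: seg_path (sub_path hp as_ tb) st. Qed.

Lemma seg_sym x y : seg x y = seg y x.
Proof.
have [->//|/eqP xy] := eqVneq x y.
have [h [hp h0 h1 ->]] := seg_param xy.
rewrite -h0 -h1 -[in RHS](subr0 1) -[X in seg _ (h X)](subrr 1).
rewrite (seg_path (rev_path hp) ler01) eqEsubset.
by split=> _ [t /= tI <-]; exists (1 - t); rewrite /= ?subKr//;
  move: tI; rewrite !in_itv/=; lra.
Qed.

Lemma seg_l x y : seg x y x. Proof. by left. Qed.

Lemma seg_r x y : seg x y y. Proof. by rewrite seg_sym; left. Qed.

Lemma seg_sub c x y : seg c y x -> seg c x `<=` seg c y.
Proof.
have [<-|/eqP cy] := eqVneq c y; first by rewrite segxx => ->; rewrite segxx.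
have [h [hp h0 h1 ->]] := seg_param cy.
move=> [t /=]; rewrite in_itv/= => /andP[t0 t1] <-.
rewrite -h0 (seg_sub_path hp)// => _ [s /= sI <-]; exists s => //=.
by move: sI; rewrite !in_itv/=; lra.
Qed.

Lemma seg_anti c x y : seg c y x -> seg c x y -> x = y.
Proof.
have [<-|/eqP cy] := eqVneq c y; first by rewrite segxx => ->.
have [h [hp h0 h1 ->]] := seg_param cy.
move=> [t /=]; rewrite in_itv/= => /andP[t0 t1] <-.
rewrite -h0 (seg_sub_path hp)// -h1 => -[s /=]; rewrite in_itv/= => sI.
move=> /hp.2 /=; rewrite !in_itv/= => H; congr h.
have s1 : s = 1 by apply: H; [lra|rewrite ler01 lexx].
by lra.
Qed.

Lemma seg_total c e x y : seg c e x -> seg c e y -> seg c x y \/ seg c y x.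
Proof.
have [<-|/eqP ce] := eqVneq c e; first by rewrite segxx => -> ->; left; left.
have [h [hp h0 h1 ->]] := seg_param ce.
move=> [s /=]; rewrite in_itv/= => sI <- [t /=]; rewrite in_itv/= => tI <-.
rewrite -h0 !(seg_sub_path hp); [|lra..].
by case: (leP s t) => st; [right|left]; [exists s|exists t]; rewrite //= in_itv/=; lra.
Qed.

Lemma seg_compact x y : compact (seg x y).
Proof.
have [<-|/eqP xy] := eqVneq x y; first by rewrite segxx; exact: compact_set1.
have [h [hp _ _ ->]] := seg_param xy.
by apply: continuous_compact hp.1 _; exact: segment_compact.
Qed.

Lemma seg_closed x y : closed (seg x y).
Proof. by apply: compact_closed; [exact: metric_hausdorff|exact: seg_compact]. Qed.

Lemma seg_connected x y : connected (seg x y).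
Proof.
have [<-|/eqP xy] := eqVneq x y; first by rewrite segxx; exact: connected1.
have [h [hp _ _ ->]] := seg_param xy.
by apply: connected_continuous_connected hp.1; exact: segment_connected.
Qed.

(** Going from a to c and then from c to b one passes through an arc from a to b,
    which by uniqueness is the segment. *)
Lemma seg_triangle a b c : seg a b `<=` seg a c `|` seg c b.
Proof.
have [<-|/eqP ab] := eqVneq a b; first by rewrite segxx => _ ->; left; left.
have [<-|/eqP ca] := eqVneq c a; first by move=> w; right.
have [<-|/eqP cb] := eqVneq c b; first by move=> w; left.
rewrite (seg_sym a c).
have [h [hp h0 h1 hE]] := seg_param ca; have [k [kp k0 k1 kE]] := seg_param cb.
(* t0 will be the last time at which h lies on seg c b *)
pose D : set R := [set t : R | t \in `[0, 1] /\ seg c b (h t)].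
have cD : compact D.
  apply: (subclosed_compact _ (@segment_compact R 0 1)); last by move=> t [].
  have /continuous_closedP/(_ _ (seg_closed (x := c) (y := b))) := hp.1.
  move/closed_subspaceP => [V cV VE].
  suff -> : D = V `&` `[0, 1] by apply: closedI => //; exact: interval_closed.
  by rewrite VE eqEsubset; split=> t [].
have D0 : D 0 by split; [rewrite in_itv/= lexx ler01|rewrite h0; exact: seg_l].
have cid : continuous (@id R) by move=> t; exact: cvg_id.
have [t0] := compact_EVT_max (ex_intro _ _ D0) cD (continuous_subspaceT cid).
rewrite inE => -[t0I]; rewrite kE => -[s0 /= s0I hk0] t0max.
set m := fun t : R => if t <= 0 then h (t0 - t) else k (s0 + t).
have mp : inj_path (t0 - 1) (1 - s0) m.
  apply: bent_path => // t s; rewrite !in_itv/= => tI sI hks.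
  apply/eqP; rewrite eq_le; move: t0I s0I; rewrite !in_itv/= => t0I s0I.
  apply/andP; split; last by lra.
  apply: t0max; rewrite inE; split; first by rewrite in_itv/=; lra.
  by rewrite hks; exists s => //=; rewrite in_itv/=; lra.
move: t0I s0I; rewrite !in_itv/= => t0I s0I.
have m0 : m (t0 - 1) = a by rewrite /m ifT ?subKr//; lra.
have m1 : m (1 - s0) = b.
  rewrite /m; case: ifPn => [s1|_]; last by rewrite addrC subrK.
  have s01 : s0 = 1 by lra.
  by rewrite -k1 -s01 hk0 subrr subr0.
have lt_dom : t0 - 1 < 1 - s0.
  rewrite lt_neqAle; apply/andP; split; last by lra.
  by apply/eqP => E; apply: ab; rewrite -m0 -m1 E.
have abE := seg_path mp (ltW lt_dom); rewrite m0 m1 in abE.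
rewrite abE => w [t /=]; rewrite in_itv/= => tI <-.
rewrite /m hE; case: ifPn => t_le0; [left; exists (t0 - t)|right; exists (s0 + t)] => //=.
  by rewrite in_itv/=; lra.
by rewrite in_itv/=; move: t_le0; rewrite -ltNge; lra.
Qed.

Lemma seg_trans_l c x y w : seg c y x -> seg x y w -> seg c w x.
Proof.
move=> xS wS; have [|] := seg_triangle w xS; first by [].
rewrite seg_sym => xyw; move: wS; rewrite seg_sym => wyx.
by rewrite (seg_anti wyx xyw); exact: seg_r.
Qed.

Lemma seg_between c x w y : seg c y w -> seg c w x -> seg x y w.
Proof.
move=> wy xw; have [wx|//] := seg_triangle x wy.
by rewrite (seg_anti xw wx); exact: seg_l.
Qed.

Lemma seg_sub_r c x y : seg c y x -> seg x y `<=` seg c y.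
Proof. by rewrite (seg_sym c) (seg_sym x); exact: seg_sub. Qed.

Lemma interval_param (J : set T) : interval_in J -> exists (h : R -> T) (g : T -> R),
  [/\ inj_path 0 1 h, J = h @` `[0, 1], {within J, continuous g} &
      forall u, J u -> g u \in `[0, 1] /\ h (g u) = u].
Proof.
move=> [h [g hg]]; have arcJ : arc_between (h 0) (h 1) J by exists h, g.
move: hg => [[hJ gI hK gK] [ch cg]]; exists h, g; split=> //.
- split=> // s t sI tI hst.
  by rewrite -(hK s) ?mem_setE// -(hK t) ?mem_setE// hst.
- rewrite eqEsubset; split=> [u Ju|_ [t tI <-]]; last exact: hJ.
  by exists (g u); [exact: gI|rewrite gK// inE].
- by move=> u Ju; split; [exact: gI|rewrite gK// inE].
Qed.

(** Local arcwise connectedness. It comes from the finite covering by arcs: near w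
    only arcs through w matter, and on such an arc a point close to w has a
    parameter close to that of w. *)
Lemma seg_near w (O : set T) : nbhs w O ->
  \forall w' \near w, seg w w' `<=` O.
Proof.
move=> Ow; case: hT.2 => [[x Tx]|[n [J [Jint JT]]]].
  have eqx y : y = x by have : [set: T] y by []; rewrite Tx.
  apply: nearW => w'; rewrite (eqx w') (eqx w) segxx => _ ->.
  by rewrite -(eqx w); exact: nbhs_singleton.
suff near_i i : \forall w' \near w, J i w' -> seg w w' `<=` O.
  have : \forall w' \near w, forall i, J i w' -> seg w w' `<=` O.
    exact: filter_forall.
  apply: filterS => w' Jw'; have : [set: T] w' by [].
  by rewrite -JT => -[i _ /Jw'].
have [h [g [hp JE cg gK]]] := interval_param (Jint i).
have cJ : closed (J i).
  apply: compact_closed; first exact: metric_hausdorff.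
  by rewrite JE; apply: continuous_compact hp.1 _; exact: segment_compact.
have [Jw|Jw] := pselect (J i w); last first.
  by have := open_nbhs_nbhs (conj (closed_openC cJ) Jw); apply: filterS.
have [gwI hgw] := gK _ Jw.
have /subspace_continuousP/(_ _ gwI O) := hp.1.
have Ohgw : nbhs (h (g w)) O by rewrite hgw.
move=> /(_ Ohgw) /nbhs_ballP[d /= d0 hd].
have near_g : \forall w' \near w, J i w' -> ball (g w) d (g w').
  by have /subspace_continuousP/(_ _ Jw _ (nbhsx_ballx _ _ d0)) := cg.
apply: filterS near_g => w' /= gw' Jw'; have [gw'I hgw'] := gK _ Jw'.
have := gw' Jw'; rewrite /ball/= => gd.
move: gwI gw'I; rewrite !in_itv/= => gwI gw'I u.
have hO t : (g w <= t <= g w') || (g w' <= t <= g w) -> O (h t).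
  move=> tI; apply: hd => /=; last by rewrite in_itv/=; lra.
  move: gd tI; rewrite /ball/= !ltr_norml; lra.
rewrite -[in seg _ _]hgw -hgw'; case: (leP (g w) (g w')) => gww'.
  rewrite (seg_sub_path hp); [|lra..] => -[t /=]; rewrite in_itv/= => tI <-.
  by apply: hO; rewrite tI.
rewrite seg_sym (seg_sub_path hp); [|lra..] => -[t /=]; rewrite in_itv/= => tI <-.
by apply: hO; rewrite tI orbT.
Qed.

Lemma near_seg c w x : seg c w x -> x <> w -> \forall w' \near w, seg c w' x.
Proof.
move=> xS xw; have := seg_near (near_neq xw).
apply: filterS => w' H; have [//|] := seg_triangle w' xS.
by rewrite seg_sym => /H/(_ erefl).
Qed.

(** The order defined by the root c is closed, stated in contrapositive form. *)
Lemma near_not_seg c y x : ~ seg c y x ->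
  exists A B, [/\ nbhs x A, nbhs y B & forall x' y', A x' -> B y' -> ~ seg c y' x'].
Proof.
move=> nxS; have xy : y <> x by move=> yx; apply: nxS; rewrite yx; exact: seg_r.
have := @metric_hausdorff R T; rewrite open_hausdorff => /(_ x y).
have yx : x != y by apply/eqP => /esym.
move=> /(_ yx) [[A B] /= [+ +] [oA oB AB0]]; rewrite !inE => Ax By.
exists (A `&` ~` seg c y), [set y' | seg y y' `<=` B]; split.
- apply: filterI; first exact: open_nbhs_nbhs.
  by apply: open_nbhs_nbhs; split=> //; apply: closed_openC; exact: seg_closed.
- by apply: seg_near; exact: open_nbhs_nbhs.
- move=> x' y' [Ax' nx'] yB xS; have [//|/yB Bx'] := seg_triangle y xS.
  by have : (A `&` B) x' by []; rewrite (eqP AB0).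
Qed.

(** Otherwise {y} would be open and closed in the connected set seg x y. *)
Lemma seg_dense x y (O : set T) : x <> y -> nbhs y O ->
  exists w, [/\ seg x y w, w <> x, w <> y & O w].
Proof.
move=> xy Oy; apply: contrapT => nex.
pose V := (O `&` [set z | x <> z])°.
have Vy : V y by apply: filterI => //; exact: near_neq.
have sub : seg x y `&` V `<=` [set y].
  move=> w [wS /nbhs_singleton[Ow xw]]; apply: contrapT => wy.
  by apply: nex; exists w; split=> // /esym.
have E : [set y] = seg x y.
  apply: seg_connected; first by exists y.
  - exists V; first exact: open_interior.
    by rewrite eqEsubset; split=> // _ ->; split=> //; exact: seg_r.
  - exists [set y]; first exact: closed_set1.
    by rewrite eqEsubset; split=> [_ ->|w []//]; split=> //; exact: seg_r.
by apply: xy; have := seg_l x y; rewrite -E.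
Qed.

(** A point u of the segment missing from C would cut C into the points whose
    segment to x avoids u and those whose segment to x contains it, both open. *)
Lemma connected_seg (C : set T) x y : connected C -> C x -> C y ->
  seg x y `<=` C.
Proof.
move=> cC Cx Cy u uS; apply: contrapT => nCu.
have E : C `&` [set w | ~ seg x w u] = C.
  apply: cC.
  - exists x; split=> //=; rewrite segxx => ux; apply: nCu; by rewrite ux.
  - exists [set w | ~ seg x w u] => //.
    rewrite openE => w /= nuw; have wu : u <> w.
      by move=> uw; apply: nuw; rewrite uw; exact: seg_r.
    have := seg_near (near_neq wu); apply: filterS => w' H uw'.
    by have [//|/H] := seg_triangle w uw'.
  - exists (~` [set w | seg x w u /\ u <> w]).
      apply: open_closedC; rewrite openE => w [uw nuw].
      exact: filterI (near_seg uw nuw) (near_neq nuw).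
    rewrite eqEsubset; split=> w [Cw] /=.
      by move=> nuw; split=> // -[].
    by move=> H; split=> // uw; apply: H; split=> // uw'; apply: nCu; rewrite uw'.
have [_ /(_ uS)//] : (C `&` [set w | ~ seg x w u]) y by rewrite E.
Qed.

(** An interval with endpoints a and b is seg a b, hence contained in the union of
    seg c a and seg c b. The number of chains thus does not depend on c. *)
Lemma tree_cover : exists (I : finType) (e : I -> T),
  forall c x, exists i, seg c (e i) x.
Proof.
case: hT.2 => [[x Tx]|[n [J [Jint JT]]]].
  exists unit, (fun=> x) => c y; exists tt.
  have : [set: T] y by []; rewrite Tx => ->; exact: seg_r.
have /choice[h hP] : forall i, exists h, inj_path 0 1 h /\ J i = h @` `[0, 1].
  by move=> i; have [h [g [hp JE _ _]]] := interval_param (Jint i); exists h.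
exists ('I_n.+1 * bool)%type, (fun z => h z.1 (if z.2 then 1 else 0)) => c x.
have : [set: T] x by []; rewrite -JT => -[i _].
have [hp ->] := hP i; rewrite -(seg_path hp ler01) => /(seg_triangle c)[|].
  by rewrite seg_sym; exists (i, false).
by exists (i, true).
Qed.

Lemma tree_compact : compact [set: T].
Proof.
have [I [e cov]] := tree_cover.
have [->|/set0P[c _]] := eqVneq [set: T] set0; first exact: compact0.
have -> : [set: T] = \big[setU/set0]_(i <- enum I) seg c (e i).
  rewrite -bigcup_seq eqEsubset; split=> // x _.
  by have [i ix] := cov c x; exists i => //=; rewrite mem_enum.
by apply: bigsetU_compact => i _; exact: seg_compact.
Qed.

(** * Iterates of a continuum containing a fixed point *)

(** Each point is eventually in or eventually out of the sets B m, and the limit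
    is the closure of the set Lam of points eventually in. A limit y of points of
    B m outside that closure is impossible: a point w strictly below y and close
    to it would be below points of B m for infinitely many m, hence in these B m,
    hence in Lam. *)
Lemma star_converges (c : T) (B : nat -> set T) (m0 : nat) :
    (forall m, B m c) -> (forall m y, B m y -> seg c y `<=` B m) ->
    (forall m y, (m0 <= m)%N -> B m.+1 y ->
      B m y \/ forall j, (m < j)%N -> B j y) ->
  Con_converges B.
Proof.
move=> Bc Bstar Bstep.
pose Lam := [set y | exists m, forall j, (m <= j)%N -> B j y].
have Lamc : Lam c by exists 0%N.
have clc : closure Lam c by exact: subset_closure.
have often_Lam y : (forall n, exists2 m, (n <= m)%N & B m y) -> Lam y.
  move=> often; apply: contrapT => nLam.
  have down m : (m0 <= m)%N -> B m.+1 y -> B m y.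
    by move=> mm By; have [//|stay] := Bstep m y mm By; case: nLam; exists m.+1.
  apply: nLam; exists m0 => j m0j; have [m jm Bm] := often j.
  elim: m jm Bm => [|m IH]; first by rewrite leqn0 => /eqP ->.
  rewrite leq_eqVlt => /predU1P[->//|jm] Bm.
  by apply: IH => //; apply: down => //; exact: leq_trans m0j jm.
have LamE : Lam = \bigcup_(y in Lam) seg c y.
  rewrite eqEsubset; split=> [y Ly|x [y [m Bm] xS]]; first by exists y => //; exact: seg_r.
  by exists m => j /Bm By; exact: Bstar By x xS.
exists (closure Lam).
  split; first by exists c.
    by apply: (subclosed_compact _ tree_compact) => //; exact: closed_closure.
  apply: connected_closure; rewrite LamE; apply: bigcup_connected.
    by exists c => y _; exact: seg_l.
  by move=> y _; exact: seg_connected.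
apply: hausdorff_cvg0; [by move=> n; exists c|by exists c|move=> e e0].
near=> n; split; near: n.
- apply: contrapT => /frequently far.
  pose M m := exists2 a, B m a & forall b, closure Lam b -> ~ mdist a b < e.
  have infM n : exists2 m, (n <= m)%N & M m.
    have [m nm] := far n; rewrite -existsNE => -[a]; rewrite not_implyE => -[Ba nb].
    by exists m => //; exists a => // b Lb ab; apply: nb; exists b.
  have /choice[u uP] m : exists a, M m ->
      B m a /\ forall b, closure Lam b -> ~ mdist a b < e.
    by have [[a Ba fa]|nM] := pselect (M m); [exists a|exists c].
  have [y _ ycl] := compact_cluster_seq tree_compact infM
    (fun m _ => I : [set: T] (u m)).
  have nLy : ~ closure Lam y.
    move=> Ly; have [m [_ Mm ym]] := ycl _ (mdist_nbhs y e0) 0%N.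
    by have [_ /(_ y Ly)] := uP m Mm; rewrite metric_sym.
  have cy : c <> y by move=> cy; apply: nLy; rewrite -cy.
  have nLO : nbhs y (~` closure Lam).
    by apply: open_nbhs_nbhs; split=> //; apply: closed_openC; exact: closed_closure.
  have [w [wS _ wy nLw]] := seg_dense cy nLO.
  apply: nLw; apply: subset_closure; apply: often_Lam => n.
  have [m [nm Mm wm]] := ycl _ (near_seg wS wy) n.
  by exists m => //; have [Bm _] := uP m Mm; exact: Bstar Bm w wm.
- apply: contrapT => /frequently far.
  pose M m := exists2 b, closure Lam b & forall a, B m a -> ~ mdist b a < e.
  have infM n : exists2 m, (n <= m)%N & M m.
    have [m nm] := far n; rewrite -existsNE => -[a]; rewrite not_implyE => -[Ba nb].
    by exists m => //; exists a => // b Lb ab; apply: nb; exists b.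
  have /choice[u uP] m : exists b, M m ->
      closure Lam b /\ forall a, B m a -> ~ mdist b a < e.
    by have [[a Ba fa]|nM] := pselect (M m); [exists a|exists c].
  have [y _ ycl] := compact_cluster_seq tree_compact infM
    (fun m _ => I : [set: T] (u m)).
  have e2 : 0 < e / 2 by rewrite divr_gt0.
  have Ly : closure Lam y.
    apply: (@closed_closure _ Lam) => O /ycl/(_ 0%N)[m [_ Mm Om]]; exists (u m); split=> //.
    by have [] := uP m Mm.
  have [l [[k Bl] yl]] := Ly _ (mdist_nbhs y e2).
  have [m [km Mm ym]] := ycl _ (mdist_nbhs y e2) k.
  have [_ /(_ l (Bl m km))] := uP m Mm; apply.
  rewrite (le_lt_trans (metric_triangle _ y _))// (splitr e) ltrD//.
  by rewrite metric_sym.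
Unshelve. all: by end_near.
Qed.

(** With #|I| chains, #|I|.+1 consecutive terms of y cannot lie on distinct ones. *)
Lemma repeated_chain (I : finType) (e : I -> T) (c : T) :
    (forall x, exists i, seg c (e i) x) -> forall (y : nat -> T) (n : nat),
  exists p q i, [/\ (0 < q <= #|I|)%N, (n <= p)%N, (p + q <= n + #|I|)%N,
    seg c (e i) (y p) & seg c (e i) (y (p + q)%N)].
Proof.
move=> cov y n.
have /choice[b bP] : forall l : 'I_#|I|.+1, exists i, seg c (e i) (y (n + l)%N).
  by move=> l; exact: cov.
have /injectivePn[l [l' ll' bb']] : ~~ injectiveb b.
  by apply/negP => /injectiveP /leq_card; rewrite card_ord ltnn.
wlog ltll' : l l' ll' bb' / (l < l')%N.
  move=> H; move: (ll'); rewrite neq_ltn => /orP[|] lt; first exact: (H l l').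
  by apply: (H l' l) => //; rewrite eq_sym.
have l'I : (l' <= #|I|)%N by rewrite -ltnS.
exists (n + l)%N, (l' - l)%N, (b l).
rewrite -addnA subnKC ?(ltnW ltll')//; split; rewrite ?leq_addr ?leq_add2l//.
  by rewrite subn_gt0 ltll' (leq_trans (leq_subr _ _)).
by rewrite bb'; exact: bP.
Qed.

Section fixed_point.
Context (h : T -> T) (ch : continuous h) (c : T) (hc : h c = c).
Context (A : set T) (cA : connected A) (Ac : A c).

Let B n := iter n h @` A.

Lemma iter_fixed n : iter n h c = c.
Proof. by elim: n => //= n ->. Qed.

Lemma images_center n : B n c.
Proof. by exists c => //; exact: iter_fixed. Qed.

Lemma image_connected n (S : set T) : connected S -> connected (iter n h @` S).
Proof.
move=> cS; apply: connected_continuous_connected => //.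
by apply: continuous_subspaceT; exact: iter_continuous.
Qed.

Lemma images_star n y : B n y -> seg c y `<=` B n.
Proof.
by move=> By; apply: connected_seg By; [exact: image_connected|exact: images_center].
Qed.

Lemma images_shift m n y : B m y -> B (n + m) (iter n h y).
Proof. by move=> [x Ax <-]; exists x => //; rewrite iterD. Qed.

(** Points of S are reached from S in q steps, hence in a * q steps: the orbits
    can be prolonged backwards inside S. *)
Lemma expanding_seg (S : set T) (q a n : nat) : S `<=` iter q h @` S ->
  iter n h @` S `<=` iter (n + a * q) h @` S.
Proof.
move=> Sq; elim: a => [|a IH]; first by rewrite mul0n addn0.
move=> y /IH[x /Sq[x' Sx' <-] <-]; exists x' => //.
by rewrite -iterD mulSn addnA [(n + q)%N]addnC -addnA [(q + _)%N]addnC.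
Qed.

(** The bound on n provides #|I|.+1 * N disjoint windows of #|I|.+1 consecutive
    times, each with two points of the orbit on one chain. In the first alternative
    below one such pair goes up, in the second all pairs go down; a length q that
    occurs N times among the latter is skipped N / q times. *)
Lemma skip_or_stay (I : finType) (e : I -> T) (N : nat) : (0 < N)%N ->
    (forall q, (0 < q <= #|I|)%N -> (q %| N)%N) ->
    (forall x, exists i, seg c (e i) x) ->
  forall n y, (#|I|.+1 * N * #|I|.+1 <= n)%N -> B n y ->
    (exists2 m, (m + N = n)%N & B m y) \/ (forall a, B (n + a * N) y).
Proof.
move=> N_gt0 dvdN cov n y nN [y0 Ay0 y0E]; set K := #|I| in dvdN nN *.
pose Y l := iter l h y0.
have YD l m : Y (l + m)%N = iter l h (Y m) by rewrite /Y iterD.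
have [[p [q [q_gt0 qK pqn grow]]]|nogrow] := pselect (exists p q,
    [/\ (0 < q)%N, (q <= K)%N, (p + q <= n)%N & seg c (Y (p + q)%N) (Y p)]).
  right=> a; have dvdqN : (q %| N)%N by rewrite dvdN// q_gt0.
  have segq : seg c (Y p) `<=` iter q h @` seg c (Y p).
    have conn : connected (iter q h @` seg c (Y p)).
      by apply: image_connected; exact: seg_connected.
    have inC : (iter q h @` seg c (Y p)) c.
      by exists c; [exact: seg_l|exact: iter_fixed].
    apply: connected_seg => //.
    apply: (connected_seg conn inC _ grow).
    by exists (Y p); [exact: seg_r|rewrite -YD addnC].
  have pn : (p <= n)%N by rewrite (leq_trans _ pqn)// leq_addr.
  have /(expanding_seg (a * (N %/ q)) segq)[x xS <-] :
      (iter (n - p) h @` seg c (Y p)) y.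
    by exists (Y p); [exact: seg_r|rewrite -YD subnK].
  rewrite -mulnA divnK//.
  have -> : (n + a * N = n - p + a * N + p)%N by rewrite addnAC subnK.
  by apply: images_shift; apply: images_star xS; exists y0.
left.
have window t : exists pq : nat * nat, [/\ (0 < pq.2)%N, (pq.2 <= K)%N,
    (t * K.+1 <= pq.1)%N, (pq.1 + pq.2 < t.+1 * K.+1)%N &
    (t.+1 * K.+1 <= n)%N -> seg c (Y pq.1) (Y (pq.1 + pq.2)%N)].
  have [p [q [i [/andP[q_gt0 qK] tp pqt ip ipq]]]] :=
    repeated_chain cov Y (t * K.+1).
  have pq_lt : (p + q < t.+1 * K.+1)%N by rewrite mulSn addSn ltnS [(K + _)%N]addnC.
  exists (p, q); split=> //= tn; have [//|grow] := seg_total ip ipq.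
  case: nogrow; exists p, q; split=> //.
  exact: leq_trans (ltnW pq_lt) tn.
have {window}[pq pqP] := choice window.
(* m is the number of steps that remain out of t * K.+1 when the r steps between
   the two points of a pair are left out in j of the first t windows *)
have skips (r t j : nat) : (t * K.+1 <= n)%N ->
    (j <= \sum_(s < t) ((pq s).2 == r))%N ->
    exists2 m, (m + r * j = t * K.+1)%N & B m (Y (t * K.+1)%N).
  elim: t j => [|t IH] j tn.
    rewrite big_ord0 leqn0 => /eqP ->; exists 0%N; first by rewrite muln0.
    by rewrite mul0n; exists y0.
  have tn' : (t * K.+1 <= n)%N by rewrite (leq_trans _ tn)// leq_mul2r leqnSn orbT.
  set Z := Y (t.+1 * K.+1)%N; rewrite big_ord_recr/=.
  case: (ltnP (\sum_(s < t) ((pq s).2 == r)) j); last first.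
    move=> /(IH _ tn')[m mE Bm] _; exists (K.+1 + m)%N.
      by rewrite -addnA mE mulSn.
    by rewrite /Z mulSn YD; exact: images_shift.
  case: eqP => [pqr|_]; last by rewrite addn0 => /leq_trans/[apply]; rewrite ltnn.
  rewrite addn1; case: j => // j; rewrite !ltnS => jle jge.
  have [m mE Bm] := IH _ tn' jge.
  have [q0 qK tp pqt decr] := pqP t.
  pose d1 := ((pq t).1 - t * K.+1)%N.
  pose d2 := (t.+1 * K.+1 - ((pq t).1 + (pq t).2))%N.
  exists (d2 + (d1 + m))%N.
    by rewrite /d1 /d2 mulnS; move: (ltnW pqt) tp mE pqr; rewrite mulSn; lia.
  have -> : Z = Y (d2 + ((pq t).1 + (pq t).2))%N by rewrite subnK// ltnW.
  rewrite YD; apply: images_shift; apply: images_star (decr tn).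
  have -> : Y (pq t).1 = iter d1 h (Y (t * K.+1)%N) by rewrite -YD subnK.
  exact: images_shift.
have pqK s : ((pq s).2 <= K)%N by have [] := pqP s.
have [r rN] := pigeonhole_count N_gt0 pqK.
have [[s sr]|nor] := pselect (exists s, (pq s).2 = r); last first.
  have sum0 : (\sum_(s < K.+1 * N) ((pq s).2 == r) = 0)%N.
    apply: big1 => s _; apply/eqP; rewrite eqb0; apply/eqP => sr.
    by apply: nor; exists s.
  by move: rN; rewrite sum0 leqNgt N_gt0.
have [r0 rK _ _ _] := pqP s; rewrite sr in r0 rK.
have rdvd : (r %| N)%N by rewrite dvdN// r0.
have [m mE Bm] := skips r _ (N %/ r)%N nN (leq_trans (leq_div _ _) rN).
exists (n - K.+1 * N * K.+1 + m)%N.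
  by rewrite -addnA -[X in (m + X)%N](divnK rdvd) [((N %/ r) * r)%N]mulnC mE subnK.
rewrite -y0E -/(Y n) -[n in Y n](subnK nN) YD; exact: images_shift.
Qed.

Lemma fixed_point_converges : exists2 N : nat, (0 < N)%N &
  forall s, Con_converges (fun m => iter (s + N * m) h @` A).
Proof.
have [I [e cov]] := tree_cover.
have [N N_gt0 dvdN] : exists2 N : nat, (0 < N)%N &
    forall q, (0 < q <= #|I|)%N -> (q %| N)%N.
  by exists (#|I|)`! => [|q]; [exact: fact_gt0|exact: dvdn_fact].
exists N => // s; pose b := (#|I|.+1 * N * #|I|.+1)%N.
apply: (@star_converges c _ b) => [m|m y|m y bm].
- exact: images_center.
- exact: images_star.
- rewrite mulnS addnCA addnC => By.
  have bn : (b <= s + N * m + N)%N.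
    rewrite -addnA (leq_trans bm)// (leq_trans _ (leq_addl _ _))//.
    by rewrite (leq_trans _ (leq_addr _ _))// leq_pmull.
  have [[k kE Bk]|stay] := skip_or_stay N_gt0 dvdN (cov c) bn By.
    by left; rewrite -(addIn kE).
  right=> j mj; rewrite -(subnKC mj) mulnDr mulnS [(N * (j - _))%N]mulnC.
  by rewrite [(N + _)%N]addnC -addnA addnA; have := stay (j - m.+1)%N; rewrite !addnA.
Qed.

End fixed_point.

(** * Recurrent points and maximal points *)

(** Subcontinua of diameter at least e contain pairs of points at distance e; if
    (x, y) is a limit of such pairs, every interior point of seg x y lies in
    infinitely many of the sets. *)
Lemma recurrent_point (u : nat -> set T) : (forall n, u n !=set0) ->
  (forall n, connected (u n)) -> ~ (diam (u n) @[n --> \oo] --> 0%E) ->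
  exists x, forall n, exists2 m, (n <= m)%N & u m x.
Proof.
move=> u0 cu ndiam.
have [e e0 far] : exists2 e : R, 0 < e & forall n, exists2 m, (n <= m)%N &
    exists z : T * T, [/\ u m z.1, u m z.2 & e <= mdist z.1 z.2].
  apply: contrapT => nex; apply: ndiam; apply: diam_cvg0 => // e e0.
  apply: contrapT => /frequently H; apply: nex; exists e => // n.
  have [m nm nsmall] := H n; exists m => //; apply: contrapT => nz.
  apply: nsmall => x y ux uy; rewrite ltNge; apply/negP => xy.
  by apply: nz; exists (x, y).
pose M m := exists z : T * T, [/\ u m z.1, u m z.2 & e <= mdist z.1 z.2].
have /choice[v vP] m : exists z : T * T,
    M m -> [/\ u m z.1, u m z.2 & e <= mdist z.1 z.2].
  by have [[z zP]|nM] := pselect (M m); [exists z|have [x _] := u0 0%N; exists (x, x)].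
have [] := compact_cluster_seq (compact_setX tree_compact tree_compact) far
  (u := v) (fun m _ => conj I I).
move=> [x y] _ cl.
have xy : x <> y.
  move=> xy; have e2 : 0 < e / 2 by rewrite divr_gt0.
  pose Ox := [set x' | mdist x x' < e / 2]; pose Oy := [set y' | mdist y y' < e / 2].
  have [|m [_ Mm [/= xv yv]]] := cl (Ox `*` Oy) _ 0%N.
    by exists (Ox, Oy) => //; split; exact: mdist_nbhs.
  have [_ _] := vP m Mm; apply/negP; rewrite -ltNge.
  rewrite (le_lt_trans (metric_triangle _ x _))// (splitr e) ltrD// ?(metric_sym _ x)//.
  by rewrite xy.
have [w [wS wx wy _]] := seg_dense xy (filterT : nbhs y setT).
exists w => n.
have near_x := seg_near (near_neq wx); have near_y := seg_near (near_neq wy).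
have [|m [nm Mm [/= xv yv]]] := cl ([set x' | seg x x' `<=` (fun z => w <> z)] `*`
    [set y' | seg y y' `<=` (fun z => w <> z)]) _ n.
  by exists ([set x' | seg x x' `<=` (fun z => w <> z)],
    [set y' | seg y y' `<=` (fun z => w <> z)]).
exists m => //; have [v1 v2 _] := vP m Mm.
apply: (connected_seg (cu m) v1 v2).
have [/xv//|] := seg_triangle (v m).1 wS.
move=> /(seg_triangle (v m).2)[//|]; rewrite seg_sym => /yv//.
Qed.

(** Zorn's lemma: a cluster point of a chain, followed upwards, bounds it because
    the order is closed. *)
Lemma seg_maximal (c : T) (C : set T) : compact C -> C !=set0 ->
  exists2 z, C z & forall x, C x -> seg c x z -> x = z.
Proof.
move=> cC [x0 Cx0].
pose le (a b : {x | C x}) := `[< seg c (sval b) (sval a) >].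
have [||||[z Cz] zmax] := @Zorn {x | C x} le.
- by move=> a; apply/asboolP; exact: seg_r.
- by move=> a b d /asboolP ab /asboolP bd; apply/asboolP; exact: seg_sub bd _ ab.
- move=> [a Ca] [b Cb] /asboolP/= ab /asboolP/= ba; apply: eq_exist; exact: seg_anti ab ba.
- move=> A totA; have [[a Aa]|A0] := pselect (A !=set0); last first.
    by exists (exist _ x0 Cx0) => s As; case: A0; exists s.
  pose up (a : {x | C x}) := [set x | exists b, [/\ A b, seg c (sval b) (sval a) & sval b = x]].
  pose F := filter_from A up.
  have FF : ProperFilter F.
    apply: filter_from_proper; last first.
      by move=> b Ab; exists (sval b), b; split=> //; exact: seg_r.
    apply: filter_from_filter; first by exists a.
    move=> i j Ai Aj; have [/asboolP ij|/asboolP ji] := totA i j Ai Aj;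
      [exists j => //|exists i => //]; move=> _ [b [Ab lb <-]]; split; exists b; split=> //.
      exact: seg_sub lb _ ij.
    exact: seg_sub lb _ ji.
  have FC : F C by exists a => // _ [[b Cb] [_ _ <-]].
  have [t [Ct cl]] := cC F FF FC; exists (exist _ t Ct) => s As.
  apply/asboolP; apply: contrapT => /near_not_seg[P [Q [Ps Qt nPQ]]].
  have Fs : F (up s) by exists s.
  have [_ [[b [_ sb <-]] Qb]] := cl _ _ Fs Qt.
  exact: nPQ (nbhs_singleton Ps) Qb sb.
- by exists z => // x Cx xz; have [] := zmax (exist _ x Cx) (asboolT xz).
Qed.

(** * Connected invariant sets without periodic points *)

Section drift.
Context (g : T -> T) (cg : continuous g) (U : set T) (cU : connected U).
Context (gU : forall x, U x -> U (g x)).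
Context (aperiodic : forall m x, (0 < m)%N -> U x -> iter m g x <> x).

Lemma iter_stable m x : U x -> U (iter m g x).
Proof. by move=> Ux; elim: m => //= m; exact: gU. Qed.

(** A point of the closure of U is a limit of points of U, and w is below those
    close enough to it. *)
Lemma closure_below c y w : U c -> closure U y -> seg c y w -> w <> y -> U w.
Proof.
move=> Uc cly wS wy; have [u [Uu wu]] := cly _ (near_seg wS wy).
exact: connected_seg wu.
Qed.

(** Requiring that all points below x move away from c, rather than x alone, makes
    a maximal x the first place where the drift away from c could stop. *)
Definition outward c := [set x | closure U x /\ forall w, seg c x w -> seg c (g w) w].

Lemma outward_closed c : closed (outward c).
Proof.
move=> x clx; split.
  by apply: (@closed_closure _ U) => O /clx[x' [[cl' _] Ox']]; exists x'.
move=> w wS; have [wx|wx] := pselect (w = x); last first.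
  by have [x' [[_ H] /H]] := clx _ (near_seg wS wx).
rewrite wx; apply: contrapT => /near_not_seg[P [P' [Px P'x nPP]]].
have [x' [[_ H] [Px' P'x']]] := clx _ (filterI Px (cg P'x)).
exact: nPP Px' P'x' (H _ (seg_r _ _)).
Qed.

(** At a maximal point z of outward c that lay in U, one would have z <> g z, and
    by continuity the points slightly beyond z towards g z would still be moved
    away from c, so that they would belong to outward c as well. *)
Lemma drift_end c : U c -> exists2 z, ~ U z & outward c z.
Proof.
move=> Uc; have Qc : outward c c.
  by split; [exact: subset_closure|rewrite segxx => _ ->; exact: seg_l].
have cQ : compact (outward c).
  by apply: (subclosed_compact _ tree_compact) => //; exact: outward_closed.
have [z Qz zmax] := seg_maximal c cQ (ex_intro _ c Qc).
have [clz zup] := Qz; have zg := zup z (seg_r _ _).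
exists z => // Uz; have zgz : z <> g z by move=> /esym; exact: (aperiodic (m := 1)).
have [v [vS vz vgz _]] := seg_dense zgz (filterT : nbhs (g z) setT).
have vg : seg c (g z) v by exact: seg_sub_r vS.
have near_up : \forall x \near z, seg c (g x) v.
  exact: cg (near_seg vg vgz).
have vz' : seg v z z by exact: seg_r.
have [x [xS xv xz near_x]] := seg_dense vz (seg_near near_up).
have zv : seg c v z by exact: seg_trans_l zg vS.
have xS' : seg z v x by rewrite seg_sym.
have Ux : U x.
  by apply: (connected_seg cU Uz (gU Uz)); exact: seg_sub xS'.
apply: xz; apply: zmax; last exact: seg_trans_l zv xS'.
split=> [|w /(seg_triangle z)[/zup//|wS]]; first exact: subset_closure.
apply: seg_sub (near_x w wS) _ _.
by apply: seg_sub_r zv _ _; exact: seg_sub xS' _ wS.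
Qed.

Section attraction.
Context (c z : T) (Uc : U c) (nUz : ~ U z) (Qz : outward c z).
Context (I : finType) (e : I -> T) (cov : forall c x, exists i, seg c (e i) x).
Context (x0 : T) (x0S : seg c z x0) (x0z : x0 <> z).
Context (x0e : forall i, seg c (e i) x0 -> seg c (e i) z).

(** Since x0 is chosen on seg c z above the points where the finitely many chains
    rooted at c that avoid z leave it, the trap is the part of U between x0 and z
    ([trap_below]); there g pushes every point towards z. *)
Definition trap := [set w | U w /\ seg c w x0].

Lemma trap_below w : trap w -> seg c z w.
Proof.
move=> [Uw wx0]; have [i iw] := cov c w.
have iz : seg c (e i) z by apply: x0e; exact: seg_sub iw _ wx0.
have [wz|//] := seg_total iw iz; case: nUz.
exact: connected_seg cU Uc Uw _ wz.
Qed.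

Lemma trap_iter m w : trap w -> trap (iter m g w) /\ seg c (iter m g w) w.
Proof.
move=> Vw; elim: m => [|m [Vm mw]]; first by split=> //; exact: seg_r.
have up : seg c (g (iter m g w)) (iter m g w) by apply: Qz.2; exact: trap_below.
split; last exact: seg_sub up _ mw.
by split; [apply: gU; exact: Vm.1|exact: seg_sub up _ Vm.2].
Qed.

Lemma trap_nbhs : \forall w \near z, seg c w x0 /\ x0 <> w.
Proof. exact: filterI (near_seg x0S x0z) (near_neq x0z). Qed.

(** If w were between z and its image under h = iter m g, consider on the segment
    from w to a point x1 of the trap the points that lie between z and their
    image. The point w is one of them and x1 is not, so there is a last one y; by
    continuity y is fixed by h, which is excluded. *)
Lemma never_behind m w : (0 < m)%N -> U w -> ~ seg z (iter m g w) w.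
Proof.
move=> m0 Uw behind; set h := iter m g in behind.
have wz : w <> z by move=> wz; apply: nUz; rewrite -wz.
have ch : continuous h by exact: iter_continuous.
have [x1 [x1S x1w x1z [x1V _]]] := seg_dense wz trap_nbhs.
have clz : closure U z := Qz.1.
have Vx1 : trap x1 by split=> //; exact: closure_below Uw clz x1S x1z.
have [Vh hx1] := trap_iter m Vx1; rewrite -/(h x1) in Vh hx1.
have hx1z : seg z x1 (h x1) by rewrite seg_sym; exact: seg_between (trap_below Vh) hx1.
pose P := seg w x1 `&` [set x | seg z (h x) x].
have cP : compact P.
  apply: compact_closedI; first exact: seg_compact.
  move=> x clx; apply: contrapT => /near_not_seg[A [B [Ax Bx nAB]]].
  have [x' [x'P [Ax' Bx']]] := clx _ (filterI Ax (ch _ _ Bx)).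
  exact: nAB Ax' Bx' x'P.
have Pw : P w by split; [exact: seg_l|].
have [y [yS yh] ymax] := seg_maximal w cP (ex_intro _ w Pw).
have Uy : U y by exact: connected_seg cU Uw Vx1.1 _ yS.
have yx1 : x1 <> y.
  by move=> x1y; apply: (aperiodic m0 Vx1.1); apply: seg_anti hx1z _; rewrite x1y.
have hyy : y <> h y by move=> /esym; exact: aperiodic.
have near_y : \forall x \near y, seg z (h x) y.
  exact: ch (near_seg yh hyy).
have [x [xS xx1 xy xh]] := seg_dense yx1 near_y.
have x1y : seg y z x1 by exact: seg_between x1S yS.
rewrite seg_sym in xS.
apply: xy; apply: ymax; last exact: seg_trans_l yS xS.
split; first exact: seg_sub_r yS _ xS.
by apply: seg_sub xh _ _; rewrite seg_sym; exact: seg_sub x1y _ xS.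
Qed.

(** Infinitely often the orbit meets one chain rooted at z at two times q steps
    apart, q fixed. On that chain it descends towards z, so its limit v there is
    fixed by g^q. As v is below points of U, it is z: otherwise it would be a
    periodic point in U. *)
Lemma orbit_trapped w : U w -> exists n, trap (iter n g w) /\ x0 <> iter n g w.
Proof.
move=> Uw; pose y n := iter n g w.
have yD l m : y (l + m)%N = iter l g (y m) by rewrite /y iterD.
have Uy n : U (y n) by exact: iter_stable.
pose M (iq : I * 'I_#|I|.+1) p := [/\ (0 < iq.2)%N, seg z (e iq.1) (y p) &
  seg z (e iq.1) (y (p + iq.2)%N)].
have [[i q] often] : exists iq, forall n, exists2 p, (n <= p)%N & M iq p.
  apply: pigeonhole_frequently => n.
  have [p [q [i [/andP[q0 qI] np _ ip ipq]]]] := repeated_chain (cov z) y n.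
  by exists p => //; exists (i, Ordinal (qI : (q < #|I|.+1)%N)); split.
have [_ _ [/= q0 _ _]] := often 0%N.
have decr m n : (m < n)%N -> seg z (e i) (y m) -> seg z (e i) (y n) ->
    seg z (y m) (y n).
  move=> mn ym yn; have [//|] := seg_total ym yn.
  have -> : y n = iter (n - m) g (y m) by rewrite -yD subnK// ltnW.
  by move/never_behind; case; rewrite ?subn_gt0.
have [v _ vcl] := compact_cluster_seq tree_compact often
  (fun m _ => Logic.I : [set: T] (y m)).
have below p : seg z (e i) (y p) -> seg z (y p) v.
  move=> yp; apply: contrapT => /near_not_seg[A [B [Av Bp nAB]]].
  have [m [pm [_ ym _] Am]] := vcl _ Av p.+1.
  exact: nAB Am (nbhs_singleton Bp) (decr _ _ pm yp ym).
have cq : continuous (iter q g) by exact: iter_continuous.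
have qv : iter q g v = v.
  apply: (seg_anti (c := z)).
    apply: contrapT => /near_not_seg[A [B [Av Bv nAB]]].
    have [p [_ [_ yp _] Bp]] := vcl _ Bv 0%N.
    have [m [pm [_ _ ym] Am]] := vcl _ (cq _ _ Av) p.+1.
    rewrite addnC yD in ym; apply: nAB Am Bp _.
    rewrite -yD; apply: decr => //; first by rewrite (leq_trans pm)// leq_addl.
    by rewrite yD.
  apply: contrapT => /near_not_seg[A [B [Av Bv nAB]]].
  have [p [_ [_ _ yp] Bp]] := vcl _ (cq _ _ Bv) 0%N.
  apply: nAB (nbhs_singleton Av) Bp _.
  by rewrite -yD addnC; exact: below.
have vz : v = z.
  apply: contrapT => vz; have [p [_ [_ yp _] _]] := vcl _ filterT 0%N.
  apply: (aperiodic q0) qv; apply: closure_below (Uy p) Qz.1 _ vz.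
  by rewrite seg_sym; exact: below.
rewrite vz in vcl; have [p [_ _ [yp x0p]]] := vcl _ trap_nbhs 0%N.
by exists p; split=> //; split=> //; exact: Uy.
Qed.

Lemma compact_trapped (A : set T) : compact A -> A `<=` U ->
  \forall n \near \oo, iter n g @` A `<=` trap.
Proof.
move=> /compact_near_coveringP cA AU.
have H x : A x -> \forall x' \near x & n \near \oo, U x' -> trap (iter n g x').
  move=> /AU /orbit_trapped[k [[_ xk] x0k]].
  exists ([set x' | seg c (iter k g x') x0], [set n | (k <= n)%N]).
    split; last by exists k.
    exact: (@iter_continuous _ _ k cg) (near_seg xk x0k).
  move=> [x' n] /= [x'k kn] Ux'; rewrite -(subnK kn) iterD.
  by apply: (trap_iter _ _).1; split=> //; exact: iter_stable.
have : \forall n \near \oo, A `<=` (fun x => U x -> trap (iter n g x)) by exact: cA.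
apply: filterS => n An _ [x Ax <-].
exact: An Ax (AU _ Ax).
Qed.

End attraction.

(** The trap can be taken inside any given neighbourhood of z. *)
Lemma drift_converges c : U c -> exists z : T,
  forall A O : set T, compact A -> A `<=` U -> nbhs z O ->
    \forall n \near \oo, iter n g @` A `<=` O.
Proof.
move=> Uc; have [z nUz Qz] := drift_end Uc; exists z => A O cA AU Oz.
have [I [e cov]] := tree_cover.
have cz : c <> z by move=> cz; apply: nUz; rewrite -cz.
have near_e : \forall x \near z, forall i, seg c (e i) x -> seg c (e i) z.
  apply: filter_forall => i; have [iz|niz] := pselect (seg c (e i) z).
    exact: nearW.
  have := open_nbhs_nbhs (conj (closed_openC (seg_closed (x := c) (y := e i))) niz).
  by apply: filterS => x.
have [x0 [x0S _ x0z [x0e x0O]]] := seg_dense cz (filterI near_e (seg_near Oz)).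
have := compact_trapped Uc nUz Qz cov x0S x0z x0e cA AU.
apply: filterS => n AV y /AV Vy; apply: x0O; rewrite seg_sym.
exact: seg_between (trap_below Uc nUz cov x0e Vy) Vy.2.
Qed.

End drift.

(** * The dichotomy *)

Section dichotomy.
Context (f : T -> T) (cf : continuous f) (A : set T) (hA : Con A).

Let cA : connected A. Proof. by case: hA. Qed.

(** The period of the images is p * N; after p * n steps the set contains a fixed
    point of iter p f, and n more periods are skipped to land in the right residue
    class. *)
Lemma periodic_case n p x : (0 < p)%N -> (iter n f @` A) x -> iter p f x = x ->
  asymptotically_periodic f A.
Proof.
move=> p0 Ax px; pose g := iter p f; pose c := iter (p * n - n) f x.
have gc : g c = c by rewrite /g /c -iterD addnC iterD px.
have pn : (n <= p * n)%N by rewrite leq_pmull.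
have A'c : (iter (p * n) f @` A) c.
  by rewrite -[(p * n)%N](subnK pn) -iter_image; exists x.
have cA' : connected (iter (p * n) f @` A) by exact: image_connected.
have cg : continuous g by exact: iter_continuous.
have [N N0 conv] := fixed_point_converges cg gc cA' A'c.
exists (p * N)%N; first by rewrite muln_gt0 p0.
apply: (Con_converges_shift (k := n)); have := conv (N * n - n)%N.
congr Con_converges; apply/funext => m.
have -> : iter (N * n - n + N * m) g = iter ((N * n - n + N * m) * p) f.
  by apply/funext => y; rewrite iterM.
rewrite iter_image [(p * n)%N]mulnC -mulnDl addnAC subnK ?leq_pmull//.
by rewrite -mulnDr mulnC mulnA [(n + m)%N]addnC.
Qed.

Lemma aperiodic_case :
  (forall n p x, (0 < p)%N -> (iter n f @` A) x -> iter p f x <> x) ->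
  asymptotically_degenerate f A.
Proof.
move=> aper; have [[a Aa] kA _] := hA.
have A0 n : iter n f @` A !=set0 by exists (iter n f a), a.
have cAn n : connected (iter n f @` A) by exact: image_connected.
apply: contrapT => ndeg; have [u often] := recurrent_point A0 cAn ndeg.
have [r _ ru] := often 0%N; have [r' rr' ru'] := often r.+1.
pose p := (r' - r)%N; have p0 : (0 < p)%N by rewrite subn_gt0.
pose g := iter p f; pose B n := iter n g @` (iter r f @` A).
have BE n : B n = iter (n * p + r) f @` A.
  rewrite /B (_ : iter n g = iter (n * p) f) ?iter_image//.
  by apply/funext => x; rewrite iterM.
pose U := \bigcup_n B n.
have cU : connected U.
  apply: chain_connected => n; first by rewrite BE.
  exists (iter (n * p) f u); rewrite !BE; split.
    by rewrite -iter_image; exists u.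
  rewrite mulSn [(p + _)%N]addnC -addnA subnK ?(ltnW rr')// -iter_image.
  by exists u.
have gU x : U x -> U (g x).
  by move=> [n _ [y Ay <-]]; exists n.+1 => //; exists y.
have Uaper m x : (0 < m)%N -> U x -> iter m g x <> x.
  move=> m0 [n _]; rewrite BE => xA; rewrite /g -iterM.
  by apply: aper xA; rewrite muln_gt0 m0.
have cg : continuous g by exact: iter_continuous.
have Ur : iter r f @` A `<=` U by move=> x xA; exists 0%N => //; exists x.
have kAr : compact (iter r f @` A).
  apply: continuous_compact kA; apply: continuous_subspaceT.
  exact: iter_continuous.
have [z zlim] := drift_converges cg cU gU Uaper (Ur u ru).
apply: ndeg; apply: diam_cvg0 => // e e0.
have e2 : 0 < e / 2 by rewrite divr_gt0.
have [k _ kP] : \forall n \near \oo, iter n g @` (iter r f @` A) `<=`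
    [set x | forall s : 'I_p, mdist (iter s f z) (iter s f x) < e / 2].
  apply: zlim => //; apply: filter_forall => s.
  exact: (@iter_continuous _ _ s cf) (mdist_nbhs (iter s f z) e2).
exists (k.+1 * p + r)%N => // n /= kn x y.
pose m := ((n - r) %/ p)%N; pose s := ((n - r) %% p)%N.
have sp : (s < p)%N by rewrite ltn_mod.
have rn : (r <= n)%N by rewrite (leq_trans _ kn)// leq_addl.
have nE : (n = s + (m * p + r))%N by rewrite addnA [(s + _)%N]addnC -divn_eq subnK.
have km : (k <= m)%N.
  rewrite leq_divRL// leq_subRL// addnC (leq_trans _ kn)// leq_add2r.
  by rewrite leq_mul2r leqnSn orbT.
have close w : (iter n f @` A) w -> mdist (iter s f z) w < e / 2.
  rewrite nE -iter_image -BE => -[w' /(kP m km)/(_ (Ordinal sp))/= + <-].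
  by [].
move=> /close xe /close ye; rewrite (le_lt_trans (metric_triangle _ (iter s f z) _))//.
by rewrite (splitr e) ltrD// metric_sym.
Qed.

End dichotomy.

End tree.

Theorem theorem3 (R : realType) (T : metricType R) (hT : is_tree T)
    (f : T -> T) (hf : continuous f) (A : set T) (hA : Con A) :
  asymptotically_periodic f A \/ asymptotically_degenerate f A.
Proof.
have [[n [p [x [p0 Ax px]]]]|aper] := pselect (exists n p x,
    [/\ (0 < p)%N, (iter n f @` A) x & iter p f x = x]).
  by left; have := periodic_case hT hf hA p0 Ax px.
right; apply: (aperiodic_case hT hf hA) => n p x p0 Ax px.
by apply: aper; exists n, p, x.
Qed.
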